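(* Let $n\ge1$, let $q_k$ ($k=1,\dots,n$) be real valued locally integrable functions on $[t_0;+\infty)$, let $\alpha_k$ ($k=1,\dots,n$) be real valued locally bounded functions on $[t_0;+\infty)$, and let $p$ be a positive function on $[t_0;+\infty)$ with $1/p$ locally integrable on $[t_0;+\infty)$. Suppose that $q_k(t)\ge0$ for $t\ge t_0$ and $\lim_{t\to+\infty}\alpha_k(t)=+\infty$, $k=1,\dots,n$. Let $\Omega_+$ be the set of those $k\in\{1,\dots,n\}$ for which there is $t_k\ge t_0$ with $\alpha_k(t)\ge t$ for all $t\ge t_k$, and let $\Omega_-$ be the set of those $k\in\{1,\dots,n\}$ for which there is $t_k\ge t_0$ with $\alpha_k(t)\le t$ for all $t\ge t_k$. Suppose $\Omega_+\neq\emptyset$, $\Omega_-\neq\emptyset$, and that both ordinary differential equations $$(p(t)\phi'(t))'+\Bigl[\sum_{k\in\Omega_+}q_k(t)\Bigr]\phi(t)=0,\quad t\ge t_0,\qquad\text{and}\qquad (p(t)\phi'(t))'+\Bigl[\sum_{k\in\Omega_-}q_k(t)\Bigr]\phi(t)=0,\quad t\ge t_0,$$ are oscillatory. Then the equation $$(p(t)\phi'(t))'+\sum_{k=1}^n q_k(t)\phi(\alpha_k(t))=0,\qquad t\ge t_0,$$ is oscillatory.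
   Context: Let $T_0=\min\{t_0,\ \inf_{t\ge t_0,\,1\le k\le n}\alpha_k(t)\}$. A solution of $(p\phi')'+\sum_k q_k(t)\phi(\alpha_k(t))=0$, $t\ge t_0$, is a real valued continuous function $\phi$ on $[T_0;+\infty)$ that is locally absolutely continuous on $[t_0;+\infty)$, such that $p\phi'$ is (after modification on a null set) locally absolutely continuous on $[t_0;+\infty)$, and such that the equation holds almost everywhere on $[t_0;+\infty)$. The same definition is used for the ordinary differential equations (which correspond to $\alpha_k(t)\equiv t$, $T_0=t_0$). An equation is called oscillatory if each of its solutions has arbitrarily large zeros. Functional equalities and inequalities are understood almost everywhere where appropriate. *)

(* Defs.v *)
From HB Require Import structures.
From mathcomp Require Export all_boot all_order all_algebra.
From mathcomp Require Export all_classical all_reals all_analysis.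
Export numFieldNormedType.Exports.

Set Implicit Arguments.
Unset Strict Implicit.
Unset Printing Implicit Defensive.
Import Order.TTheory GRing.Theory Num.Theory.

Local Open Scope classical_set_scope.
Local Open Scope ring_scope.

(* Real functions on a half line are total functions [R -> R] of which only the
   values on the half line are used.

   "Almost everywhere" is [{ae lebesgue_measure, _}]; negligible sets are subsets
   of Borel null sets, hence the usual Lebesgue null sets.  Integrability is with
   respect to the completed measure, because [lebesgue_measure.-integrable]
   would require Borel measurability. *)

Definition locally_integrable_ray (R : realType) (t0 : R) (f : R -> R) : Prop :=
  forall b : R, completed_lebesgue_measure.-integrable `[t0, b] (EFin \o f).

Definition locally_bounded_ray (R : realType) (t0 : R) (f : R -> R) : Prop :=
  forall b : R, [bounded f t | t in `[t0, b]].

Definition absolutely_continuous (R : realType) (a b : R) (f : R -> R) : Prop :=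
  forall e : R, 0 < e -> exists2 d : R, 0 < d &
    forall (m : nat) (u v : 'I_m -> R),
      (forall i, a <= u i /\ u i <= v i /\ v i <= b) ->
      trivIset setT (fun i => `]u i, v i[%classic) ->
      \sum_(i < m) (v i - u i) < d ->
      \sum_(i < m) `|f (v i) - f (u i)| < e.

Definition locally_AC_ray (R : realType) (t0 : R) (f : R -> R) : Prop :=
  forall b : R, absolutely_continuous t0 b f.

(* [inf] is the library's total infimum on [R]; it is the genuine one whenever
   the set is nonempty and bounded below. *)
Definition initial_time (R : realType) (n : nat) (t0 : R)
    (alpha : 'I_n -> R -> R) : R :=
  Num.min t0 (inf [set x | exists k : 'I_n, exists2 t, t0 <= t & x = alpha k t]).

(* Solutions of (p phi')' + \sum_k q_k(t) phi(alpha_k(t)) = 0, t >= t0.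
   [psi] is the locally absolutely continuous modification of [p phi']. *)
Definition is_solution (R : realType) (n : nat) (t0 : R) (p : R -> R)
    (q alpha : 'I_n -> R -> R) (phi : R -> R) : Prop :=
  [/\ {within `[initial_time t0 alpha, +oo[, continuous phi},
      locally_AC_ray t0 phi &
      exists psi : R -> R,
        [/\ locally_AC_ray t0 psi,
            {ae lebesgue_measure, forall t : R, t0 <= t ->
               derivable phi t 1 /\ psi t = p t * 'D_1 phi t} &
            {ae lebesgue_measure, forall t : R, t0 <= t ->
               derivable psi t 1 /\
               'D_1 psi t + \sum_(k < n) q k t * phi (alpha k t) = 0}]].

Definition oscillatory (R : realType) (n : nat) (t0 : R) (p : R -> R)
    (q alpha : 'I_n -> R -> R) : Prop :=
  forall phi : R -> R, is_solution t0 p q alpha phi ->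
    forall T : R, initial_time t0 alpha <= T -> exists2 t, T <= t & phi t = 0.

(* (p phi')' + Q(t) phi(t) = 0: one term with alpha(t) = t, for which
   [initial_time] is t0. *)
Definition ode_oscillatory (R : realType) (t0 : R) (p Q : R -> R) : Prop :=
  oscillatory t0 p (fun _ : 'I_1 => Q) (fun (_ : 'I_1) (t : R) => t).

Definition Omega_plus (R : realType) (n : nat) (t0 : R)
    (alpha : 'I_n -> R -> R) : set 'I_n :=
  [set k | exists2 tk : R, t0 <= tk &
     {ae lebesgue_measure, forall t : R, tk <= t -> t <= alpha k t}].

Definition Omega_minus (R : realType) (n : nat) (t0 : R)
    (alpha : 'I_n -> R -> R) : set 'I_n :=
  [set k | exists2 tk : R, t0 <= tk &
     {ae lebesgue_measure, forall t : R, tk <= t -> alpha k t <= t}].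

(* Main.v *)
Require Import Defs.
From mathcomp Require Import measurable_realfun ring lra.
Import Order.TTheory GRing.Theory Num.Theory.
Local Open Scope classical_set_scope.
Local Open Scope ring_scope.

Set Implicit Arguments.
Unset Strict Implicit.
Unset Printing Implicit Defensive.

(** Let [phi] be a solution without zeros from some time on.  By continuity and
    because the equation is odd, [phi] may be taken positive there.  Since every
    [alpha k] tends to infinity, the values [phi (alpha k t)] are eventually
    positive as well, so the quasi-derivative [psi = p phi'] is eventually
    nonincreasing.  If [psi] stays nonnegative, then [phi] is nondecreasing, and
    it does not decrease when [t] is replaced by an advanced argument
    [alpha k t >= t].  Otherwise [psi] is negative from some time on, [phi] is
    nonincreasing, and the same holds for the retarded arguments.  So for one of
    the two sets of indices, with [Q] the sum of its coefficients, discarding the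
    other (nonnegative) terms yields [psi' + Q phi <= 0]: one of the two ordinary
    equations has a positive supersolution ([ode_not_oscillatory_of_deviation]).

    An ordinary equation with a positive supersolution on [[T, +oo)] is not
    oscillatory ([positive_supersolution_nonoscillatory]).  Let [u], with
    quasi-derivative [v = p u'], be its solution having the same data as [phi]
    and [psi] at [T].  Before the first zero [s] of [u], the function
    [W = u psi - phi v] satisfies [W' = u (psi' + Q phi) <= 0] and [W T = 0].
    Hence [W s = - phi s * v s <= 0], that is, [v s >= 0].  But [v' = - Q u <= 0]
    before [s], so [v >= 0] and [u' >= 0] on [[T, s]], and [u s >= u T > 0], which
    is absurd ([linear_solution_gt0]).

    Two facts of real analysis carry this.  An absolutely continuous function
    whose derivative is nonpositive almost everywhere is nonincreasing ([ac_le]).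
    And the system [u' = P v], [v' = - Q u] with nonnegative locally integrable
    coefficients has a solution with any data at [T] ([linear_solution_through]).
    For the latter, writing [u] and [v] as differences removes the minus sign and
    gives a system of four equations with nonnegative coefficients; its Picard
    iterates increase and are locally bounded, and the monotone convergence theorem gives
    a solution of the integral equations ([cooperative_system]).  As the
    coefficients of the equation are only measurable for the completed
    sigma-algebra, they are first replaced by Borel functions equal to them almost
    everywhere ([borel_representative]). *)

(** * Almost everywhere statements and pointwise derivatives *)

Section almost_everywhere.
Variable R : realType.
Notation mu := (@lebesgue_measure R).

Lemma ae_conj (A B : R -> Prop) : {ae mu, forall t, A t} -> {ae mu, forall t, B t} ->
  {ae mu, forall t, A t /\ B t}.
Proof. by apply: filterS2; first exact: (ae_filter_ringOfSetsType mu). Qed.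

Lemma ae_imply (A B : R -> Prop) : {ae mu, forall t, A t} ->
  (forall t, A t -> B t) -> {ae mu, forall t, B t}.
Proof.
by move=> aeA AB; apply: filterS aeA; first exact: (ae_filter_ringOfSetsType mu).
Qed.

End almost_everywhere.

Section is_derive_pointwise.
Variable R : realType.
Variables (f g : R -> R) (s df dg : R).
Hypotheses (Df : is_derive s 1 f df) (Dg : is_derive s 1 g dg).

Lemma is_derive_add : is_derive s 1 (fun t => f t + g t) (df + dg).
Proof. exact: is_deriveD. Qed.

Lemma is_derive_sub : is_derive s 1 (fun t => f t - g t) (df - dg).
Proof. exact: is_deriveB. Qed.

Lemma is_derive_mul :
  is_derive s 1 (fun t => f t * g t) (df * g s + f s * dg).
Proof.
have := is_deriveM Df Dg; rewrite /GRing.scale /= => dfg.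
by apply: (is_derive_eq dfg); ring.
Qed.

Lemma is_derive_scale (c : R) : is_derive s 1 (fun t => c * f t) (c * df).
Proof. exact: (@is_deriveZ _ _ _ f). Qed.

Lemma is_derive_exp : is_derive s 1 (fun t => expR (f t)) (df * expR (f s)).
Proof. by rewrite mulrC; exact: (@is_derive1_comp _ expR f). Qed.
End is_derive_pointwise.

(** * Real induction and first zeros *)

(** If [P] can be carried across every point [s] of [[a, b]], then the supremum
    of the points reached from [a] is reached, and it cannot be less than [b]. *)
Lemma real_induction (R : realType) (a b : R) (P : R -> Prop) : a <= b -> P a ->
  (forall s, a <= s <= b -> exists2 r, 0 < r &
     forall x y, a <= x <= s -> s - r < x -> s <= y <= b -> y < s + r ->
       P x -> P y) ->
  P b.
Proof.
move=> ab Pa step; pose S := [set x | a <= x <= b /\ P x].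
have Sa : S a by split; rewrite ?lexx.
have ubS : ubound S b by move=> x [/andP[]].
have supS : has_sup S by split; [exists a | exists b].
have as_ : a <= sup S by apply: ub_le_sup Sa; exists b.
have sb : sup S <= b by apply: ge_sup => //; exists a.
have /step[r r0 stepr] : a <= sup S <= b by rewrite as_ sb.
have [x Sx xr] := sup_adherent r0 supS.
have xs : x <= sup S by apply: ub_le_sup => //; exists b.
have [/andP[ax _] Px] := Sx.
have Sy y : sup S <= y <= b -> y < sup S + r -> S y.
  move=> /andP[sy yb] yr; split; first by rewrite (le_trans as_ sy).
  by apply: (stepr x y) => //; rewrite ?ax ?sy.
have [bs|] := leP b (sup S); first by apply: (Sy b _ _).2; 
  rewrite ?sb ?lexx ?(le_lt_trans bs) ?ltrDl.
move=> sltb; pose y := Num.min b (sup S + r / 2).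
have r2 : 0 < r / 2 by rewrite divr_gt0.
have sy : sup S < y by rewrite /y lt_min sltb ltrDl.
have : y <= sup S.
  apply: ub_le_sup; first by exists b.
  apply: Sy; first by rewrite (ltW sy) /y ge_min lexx.
  by rewrite /y gt_min; apply/orP; right; rewrite ltrD2l; lra.
by rewrite leNgt sy.
Qed.

Section first_zero.
Variable R : realType.

(** The zero is the supremum of the points up to which [u] is positive. *)
Lemma first_zero (a b : R) (u : R -> R) : a <= b ->
  {within `[a, b], continuous u} -> 0 < u a -> u b <= 0 ->
  exists s, [/\ a < s <= b, u s = 0 & forall t, a <= t < s -> 0 < u t].
Proof.
move=> ab /subspace_continuousP cu ua ub.
pose S := [set x | a <= x <= b /\ forall t, a <= t <= x -> 0 < u t].
have Sa : S a.
  by split; [rewrite lexx | move=> t; rewrite -eq_le => /eqP <-].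
have ubS : ubound S b by move=> x [/andP[]].
have supS : has_sup S by split; [exists a | exists b].
set s := sup S.
have as_ : a <= s by apply: ub_le_sup Sa; exists b.
have sb : s <= b by apply: ge_sup => //; exists a.
have before t : a <= t < s -> 0 < u t.
  move=> /andP[at_ ts]; have := sup_adherent _ supS.
  move=> /(_ (s - t)); rewrite subr_gt0 => /(_ ts)[x [_ Sx]].
  by rewrite subKr => tx; apply: Sx; rewrite at_ ltW.
have cus e : 0 < e -> exists2 d, 0 < d & forall y, a <= y <= b -> `|s - y| < d ->
    `|u s - u y| < e.
  have /cu /cvgrPdist_lt H : `[a, b]%classic s by rewrite /= in_itv/= as_.
  move=> /H; rewrite near_withinE => /nbhs_ballP[d /= d0 Hd].
  by exists d => // y yab yd; apply: Hd => //=; rewrite in_itv.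
have us : u s = 0.
  apply/eqP; rewrite eq_le; apply/andP; split; rewrite leNgt; apply/negP => us.
    have [d d0 near_s] := cus _ us.
    have pos y : a <= y <= b -> `|s - y| < d -> 0 < u y.
      by move=> yab /(near_s y yab); rewrite ltr_norml => /andP[_]; lra.
    have sltb : s < b.
      rewrite lt_neqAle sb andbT; apply: contraTneq us => ->.
      by rewrite -leNgt.
    pose y := Num.min b (s + d / 2).
    have d2 : 0 < d / 2 by rewrite divr_gt0.
    have sy : s < y by rewrite /y lt_min sltb ltrDl.
    have yb : y <= b by rewrite /y ge_min lexx.
    have yd : y < s + d by rewrite /y gt_min; apply/orP; right; lra.
    suff : y <= s by rewrite leNgt sy.
    apply: ub_le_sup; first by exists b.
    split; first by rewrite yb (le_trans as_ (ltW sy)).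
    move=> t /andP[at_ ty]; have [ts|st] := ltP t s; first by rewrite before// at_.
    apply: pos; first by rewrite at_ (le_trans ty).
    by rewrite ler0_norm; lra.
  have slta : a < s.
    by rewrite lt_neqAle as_ andbT; apply: contraTneq us => <-; rewrite -leNgt ltW.
  have [d d0 near_s] : exists2 d, 0 < d & forall y, a <= y <= b ->
      `|s - y| < d -> `|u s - u y| < - u s.
    by apply: cus; rewrite oppr_gt0.
  pose y := Num.max a (s - d / 2).
  have d2 : 0 < d / 2 by rewrite divr_gt0.
  have ys : y < s by rewrite /y gt_max slta ltrBlDr ltrDl.
  have ay : a <= y by rewrite /y le_max lexx.
  have yd : s - d < y by rewrite /y lt_max; apply/orP; right; lra.
  have := before y; rewrite ay ys => /(_ isT) uy.
  have := near_s y; rewrite ay (le_trans (ltW ys) sb) gtr0_norm ?subr_gt0//.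
  move=> /(_ isT) H; have {}H : `|u s - u y| < - u s by apply: H; lra.
  by move: H; rewrite ltr_norml; lra.
exists s; split=> //; rewrite sb andbT lt_neqAle as_ andbT.
by apply: contraTneq ua => ->; rewrite us ltxx.
Qed.

End first_zero.

(** * Absolute continuity *)

Section ac_algebra.
Variable R : realType.
Implicit Types f g h : R -> R.

Lemma ac_sub (a b a' b' : R) f : a <= a' -> b' <= b ->
  absolutely_continuous a b f -> absolutely_continuous a' b' f.
Proof.
move=> aa bb acf e /acf[d d0 acd]; exists d => // m u v uv.
by apply: acd => i; have [? [? ?]] := uv i; split; [|split] => //; lra.
Qed.

(** A bound on the increments is all that sums, products and composition with
    a locally Lipschitz function have in common, and it suffices. *)
Lemma ac_dominated (a b K : R) f g h :
  absolutely_continuous a b f -> absolutely_continuous a b g ->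
  (forall u v, a <= u -> u <= v -> v <= b ->
     `|h v - h u| <= K * (`|f v - f u| + `|g v - g u|)) ->
  absolutely_continuous a b h.
Proof.
move=> acf acg hK e e0.
have K0 : 0 < `|K| + 1 by rewrite ltr_wpDl.
pose e' := e / (`|K| + 1) / 2.
have e'0 : 0 < e' by rewrite !divr_gt0.
have [d d0 acd] := acf e' e'0; have [d' d'0 acd'] := acg e' e'0.
exists (Num.min d d'); first by rewrite lt_min d0.
move=> m u v uv triv; rewrite lt_min => /andP[sd sd'].
apply: (@le_lt_trans _ _ ((`|K| + 1) *
    (\sum_(i < m) `|f (v i) - f (u i)| + \sum_(i < m) `|g (v i) - g (u i)|))).
  rewrite -big_split/= mulr_sumr ler_sum// => i _.
  have [au [uvi vb]] := uv i; apply: (le_trans (hK _ _ au uvi vb)).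
  rewrite ler_wpM2r// ?addr_ge0//.
  by rewrite (le_trans (ler_norm _))// lerDl.
rewrite mulrC -ltr_pdivlMr//.
have := acd m u v uv triv sd; have := acd' m u v uv triv sd'.
rewrite /e'; lra.
Qed.

Lemma ac_cst (a b c : R) : absolutely_continuous a b (fun=> c).
Proof.
move=> e e0; exists 1 => // m u v _ _ _.
by rewrite big1// => i _; rewrite subrr normr0.
Qed.

(** Families of a single interval give uniform continuity. *)
Lemma ac_modulus (a b : R) f : absolutely_continuous a b f ->
  forall e, 0 < e -> exists2 d, 0 < d & forall u v, a <= u <= b -> a <= v <= b ->
    `|v - u| < d -> `|f v - f u| < e.
Proof.
move=> acf e e0; have [d d0 acd] := acf e e0; exists d => //.
suff K u v : a <= u -> u <= v -> v <= b -> v - u < d -> `|f v - f u| < e.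
  move=> u v /andP[au ub] /andP[av vb]; have [uv|vu] := leP u v.
    by rewrite ger0_norm ?subr_ge0//; exact: K.
  by rewrite ltr0_norm ?subr_lt0// distrC opprB; apply: K => //; exact: ltW.
move=> au uv vb uvd.
have := acd 1%N (fun=> u) (fun=> v); rewrite !big_ord1; apply => //.
by apply/trivIsetP => i j; rewrite !ord1.
Qed.

Lemma ac_within_continuous (a b : R) f : absolutely_continuous a b f ->
  {within `[a, b], continuous f}.
Proof.
move=> /ac_modulus acf; apply/subspace_continuousP => x /=; rewrite in_itv/= => xab.
apply/cvgrPdist_lt => e /acf[d d0 acd].
rewrite near_withinE; apply/nbhs_ballP; exists d => // y /= xy; rewrite in_itv/= => yab.
exact: acd.
Qed.

Lemma ac_bounded (a b : R) f : absolutely_continuous a b f ->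
  exists M, forall t, a <= t <= b -> `|f t| <= M.
Proof.
have [ab|ba] := leP a b; last first.
  by move=> _; exists 0 => t /andP[at_ tb]; move: ba; rewrite ltNge (le_trans at_ tb).
move=> /ac_within_continuous cf.
have [c _ fc] := EVT_max ab cf; have [d _ fd] := EVT_min ab cf.
exists (`|f c| + `|f d|) => t tab.
have := fc t; have := fd t; rewrite !in_itv/= tab => /(_ isT) + /(_ isT).
have := ler_norm (f c); have := ler_norm (- f d); rewrite normrN.
have := normr_ge0 (f c); have := normr_ge0 (f d).
by move=> *; rewrite ler_norml; lra.
Qed.

Lemma acM (a b : R) f g : absolutely_continuous a b f ->
  absolutely_continuous a b g -> absolutely_continuous a b (fun t => f t * g t).
Proof.
move=> acf acg; have [M fM] := ac_bounded acf; have [N gN] := ac_bounded acg.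
apply: (@ac_dominated _ _ (M + N) f g) => // u v au uv vb.
have -> : f v * g v - f u * g u = f v * (g v - g u) + g u * (f v - f u) by ring.
have vab : a <= v <= b by rewrite vb (le_trans au).
have uab : a <= u <= b by rewrite au (le_trans uv).
apply: (le_trans (ler_normD _ _)); rewrite !normrM.
have := fM v vab; have := gN u uab.
have := normr_ge0 (f v); have := normr_ge0 (g u).
have := normr_ge0 (f v - f u); have := normr_ge0 (g v - g u).
nra.
Qed.

Lemma acD (a b : R) f g : absolutely_continuous a b f ->
  absolutely_continuous a b g -> absolutely_continuous a b (fun t => f t + g t).
Proof.
move=> acf acg; apply: (@ac_dominated _ _ 1 f g) => // u v _ _ _.
by rewrite mul1r opprD addrACA ler_normD.
Qed.

Lemma acN (a b : R) f : absolutely_continuous a b f ->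
  absolutely_continuous a b (fun t => - f t).
Proof.
move=> acf; apply: (@ac_dominated _ _ 1 f f) => // u v _ _ _.
by rewrite mul1r -opprD normrN lerDl.
Qed.

Lemma acB (a b : R) f g : absolutely_continuous a b f ->
  absolutely_continuous a b g -> absolutely_continuous a b (fun t => f t - g t).
Proof. by move=> acf /acN; exact: acD. Qed.

Lemma acZ (a b c : R) f : absolutely_continuous a b f ->
  absolutely_continuous a b (fun t => c * f t).
Proof. exact/acM/ac_cst. Qed.

(** The exponential is Lipschitz on the bounded range of [f], because its graph
    lies above its tangents. *)
Lemma ac_expR (a b : R) f : absolutely_continuous a b f ->
  absolutely_continuous a b (fun t => expR (f t)).
Proof.
move=> acf; have [M fM] := ac_bounded acf.
apply: (@ac_dominated _ _ (expR M) f f) => // u v au uv vb.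
have vab : a <= v <= b by rewrite vb (le_trans au).
have uab : a <= u <= b by rewrite au (le_trans uv).
have K x y : x <= M -> y <= M -> expR y - expR x <= expR M * `|y - x|.
  move=> xM yM; have := expR_ge1Dx (x - y).
  rewrite -(ler_pM2l (expR_gt0 y)) -expRD [y + (x - y)]addrC subrK => tangent.
  have eyM : expR y <= expR M by rewrite ler_expR.
  apply: (@le_trans _ _ (expR y * `|y - x|)); last by rewrite ler_wpM2r.
  apply: (@le_trans _ _ (expR y * (y - x))); last first.
    by rewrite ler_wpM2l ?ler_norm// expR_ge0.
  by move: tangent; rewrite !mulrDr mulrN mulr1; lra.
have fuM := le_trans (ler_norm _) (fM u uab).
have fvM := le_trans (ler_norm _) (fM v vab).
apply: (@le_trans _ _ (expR M * `|f v - f u|)); last first.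
  by rewrite ler_wpM2l ?expR_ge0// lerDl.
by rewrite ler_norml lerNl opprB K//= distrC K.
Qed.

Lemma locally_ac_within_continuous (t0 : R) f : locally_AC_ray t0 f ->
  {within `[t0, +oo[, continuous f}.
Proof.
move=> acf; apply/subspace_continuousP => x /=; rewrite in_itv/= andbT => t0x.
apply/cvgrPdist_lt => e /(ac_modulus (acf (x + 1)))[d d0 acd].
rewrite near_withinE; apply/nbhs_ballP; exists (Num.min 1 d) => /=.
  by rewrite lt_min ltr01.
move=> y /=; rewrite /ball/= lt_min => /andP[xy1 xyd]; rewrite in_itv/= andbT => t0y.
apply: acd => //.
  rewrite t0y/=; move: xy1; rewrite ltr_norml; lra.
by rewrite t0x/= lerDl.
Qed.

End ac_algebra.

(** * Monotonicity from the sign of the derivative almost everywhere *)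

(** Increments are compared between points on either side of [s], so that such
    estimates can be chained along an interval. *)
Lemma derive_le0_near (R : realType) (f : R -> R) (s e : R) :
  0 < e -> derivable f s 1 -> 'D_1 f s <= 0 ->
  exists2 r, 0 < r & forall x y, x <= s <= y -> s - r < x -> y < s + r ->
    f y - f x <= e * (y - x).
Proof.
move=> e0 df D0.
have : h^-1 *: (f (h + s) - f s) @[h --> 0^'] --> 'D_1 f s.
  have := df; rewrite derivable1_diffP => /derivable1_diffP.
  rewrite /derivable /derive => /cvg_ex[l].
  have -> : (fun h : R => h^-1 *: (f (h + s) - f s)) =
            (fun h => h^-1 *: ((f \o shift s) (h *: 1) - f s)).
    by apply/funext => h /=; rewrite /GRing.scale /= mulr1.
  by move=> H; rewrite (cvg_lim _ H).
move=> /cvgrPdist_lt /(_ e e0) /nbhs_ballP[r /= r0 H].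
have K h : h != 0 -> `|h| < r -> h^-1 * (f (h + s) - f s) < e.
  move=> h0 hr; have := H h; rewrite /ball /= sub0r normrN => /(_ hr h0).
  rewrite ltr_norml => /andP[/= + _]; rewrite /GRing.scale /=; lra.
exists r => // x y /andP[xs sy] sx yr.
have Hy : f y - f s <= e * (y - s).
  move: sy; rewrite le_eqVlt => /predU1P[->|sy]; first by rewrite !subrr mulr0.
  have := K (y - s); rewrite subrK => /(_ _ _)/ltW; rewrite subr_eq0 gt_eqF// => /(_ isT).
  rewrite gtr0_norm ?subr_gt0// ltrBlDl => /(_ yr).
  by rewrite mulrC ler_pdivrMr ?subr_gt0.
have Hx : f s - f x <= e * (s - x).
  move: xs; rewrite le_eqVlt => /predU1P[->|xs]; first by rewrite !subrr mulr0.
  have := K (x - s); rewrite subrK => /(_ _ _)/ltW; rewrite subr_eq0 lt_eqF// => /(_ isT).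
  rewrite ltr0_norm ?subr_lt0// opprB ltrBlDl -ltrBlDr => /(_ sx).
  by rewrite mulrC ler_ndivrMr ?subr_lt0//; lra.
have -> : e * (y - x) = e * (y - s) + e * (s - x) by ring.
lra.
Qed.

Section ac_monotone.
Variable R : realType.
Notation mu := (@lebesgue_measure R).

Lemma sum_length_le_measure (m : nat) (u v : 'I_m -> R) (U : set R) :
  measurable U -> (forall i, u i <= v i) ->
  trivIset setT (fun i => `]u i, v i[%classic) ->
  (forall i, `]u i, v i[ `<=` U) ->
  ((\sum_(i < m) (v i - u i))%:E <= mu U)%E.
Proof.
move=> mU uv triv sub.
have mI i : measurable (`]u i, v i[%classic : set R) by [].
apply: (@le_trans _ _ (mu (\big[setU/set0]_(i < m) `]u i, v i[%classic))); last first.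
  apply: le_measure; rewrite ?inE//; first exact: bigsetU_measurable.
  apply: (big_ind (fun A => A `<=` U)) => [//|A B AU BU|i _]; last exact: sub.
  by rewrite subUset.
rewrite measure_semi_additive_ord//; last exact: bigsetU_measurable.
rewrite -sumEFin lee_sum// => i _.
rewrite [leRHS]lebesgue_measure_itv/= lte_fin; case: ltP => // vu.
by rewrite lee_fin subr_le0.
Qed.

(** The graph is followed from [a] to the right, rising by at most [e] per unit of
    length near a point where the derivative is nonpositive.  The other points lie
    in an open set [U] of small measure: the steps taken inside [U] form a family
    of disjoint intervals of small total length, to which absolute continuity
    applies. *)
Lemma ac_le (a b : R) (f : R -> R) : a <= b -> absolutely_continuous a b f ->
  {ae mu, forall t, a <= t <= b -> derivable f t 1 /\ 'D_1 f t <= 0} ->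
  f b <= f a.
Proof.
move=> ab acf [N [mN N0 badN]].
suff eP e : 0 < e -> f b <= f a + e * (b - a + 1).
  apply/ler_addgt0Pr => e e0.
  have c0 : 0 < b - a + 1 by rewrite ltr_wpDl ?subr_ge0.
  have := eP (e / (b - a + 1)); rewrite divr_gt0//= mulfVK ?gt_eqF//.
  exact.
move=> e0; have [d d0 acd] := acf e e0.
have [U [oU NU UNd]] : exists U, [/\ open U, N `<=` U & (mu (U `\` N) < d%:E)%E].
  by apply: lebesgue_regularity_outer => //; rewrite [X in (X < _)%E]N0 ltry.
have mU : measurable U by exact: open_measurable.
have Ud : (mu U < d%:E)%E.
  rewrite (_ : U = N `|` (U `\` N)); last by rewrite setDUK.
  apply: le_lt_trans UNd; rewrite (le_trans (measureU2 _ _ _))//.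
    exact: measurableD.
  by rewrite [X in (X + _ <= _)%E]N0 add0e.
(* The intervals collected so far are listed from left to right, so a new one
   is disjoint from the others as soon as it starts after the last one. *)
pose good x := exists m (u v : nat -> R), [/\
  forall i, (i < m)%N -> [/\ a <= u i, u i <= v i, v i <= x & `]u i, v i[ `<=` U],
  forall i j, (i < j < m)%N -> v i <= u j &
  f x - f a <= e * (x - a) + \sum_(i < m) (f (v i) - f (u i))].
have [m [u [v [uv disj le_f]]]] : good b.
  apply: (@real_induction _ a b good ab).
    exists 0%N, (fun=> 0), (fun=> 0); split=> //.
    by rewrite big_ord0 !subrr mulr0 addr0.
  move=> s /andP[as_ sb]; have [Us|nUs] := pselect (U s).
    have /nbhs_ballP[r /= r0 sU] : nbhs s U by exact: open_nbhs_nbhs.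
    exists r => // x y /andP[ax xs] sx /andP[sy yb] yr [m [u [v [uv disj le_f]]]].
    exists m.+1, (fun i => if i == m then x else u i),
                 (fun i => if i == m then y else v i); split.
    - move=> i; rewrite ltnS leq_eqVlt; case: eqP => [-> _|_ /= /uv[? ? ? ?]].
        split=> //; first exact: le_trans sy.
        move=> z /=; rewrite in_itv/= => /andP[xz zy]; apply: sU.
        by rewrite /ball/= ltr_distlC; apply/andP; split; lra.
      by split=> //; lra.
    - move=> i j /andP[ij]; rewrite ltnS leq_eqVlt => /predU1P[jm|jm].
        by rewrite jm eqxx ltn_eqF -?jm//; have [] := uv i _; rewrite -?jm.
      by rewrite !ltn_eqF ?(ltn_trans ij)//; apply: disj; rewrite ij.
    - rewrite big_ord_recr/= eqxx.
      under eq_bigr do rewrite ltn_eqF//.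
      have : e * (x - a) <= e * (y - a) by rewrite ler_pM2l//; lra.
      lra.
  have [] : derivable f s 1 /\ 'D_1 f s <= 0.
    have : ~ N s by move/NU.
    by apply: contra_notP => h; apply: badN => /= /(_ _); rewrite as_ sb => /(_ isT).
  move=> dfs /(derive_le0_near e0 dfs)[r r0 near_f].
  exists r => // x y /andP[ax xs] sx /andP[sy yb] yr [m [u [v [uv disj le_f]]]].
  exists m, u, v; split=> //.
    by move=> i /uv[? ? ? ?]; split=> //; lra.
  have := near_f x y; rewrite xs sy => /(_ isT sx yr).
  lra.
have triv : trivIset setT (fun i : 'I_m => `]u i, v i[%classic).
  suff lt_disj (i j : 'I_m) : (i < j)%N -> `]u i, v i[ `&` `]u j, v j[ = set0.
    apply/trivIsetP => i j _ _; rewrite neq_ltn => /orP[/lt_disj//|/lt_disj].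
    by rewrite setIC.
  move=> ij; have vu : v i <= u j by apply: disj; rewrite ij/=.
  rewrite -subset0 => z [/=]; rewrite !in_itv/= => /andP[_ zv] /andP[uz _].
  by move: (lt_le_trans zv vu); rewrite ltNge (ltW uz).
have lend : \sum_(i < m) (v i - u i) < d.
  rewrite -lte_fin; apply: le_lt_trans Ud.
  by apply: sum_length_le_measure => // i; have [] := uv i (ltn_ord i).
have := acd m (fun i => u i) (fun i => v i) _ triv lend.
have uvab i : (i < m)%N -> a <= u i /\ u i <= v i /\ v i <= b.
  by move=> /uv[].
move=> /(_ (fun i => uvab i (ltn_ord i))).
have : \sum_(i < m) (f (v i) - f (u i)) <= \sum_(i < m) `|f (v i) - f (u i)|.
  by apply: ler_sum => i _; exact: ler_norm.
lra.
Qed.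

Lemma ac_ge (a b : R) (f : R -> R) : a <= b -> absolutely_continuous a b f ->
  {ae mu, forall t, a <= t <= b -> derivable f t 1 /\ 0 <= 'D_1 f t} ->
  f a <= f b.
Proof.
move=> ab acf df; rewrite -lerN2.
apply: (@ac_le a b (fun t => - f t)) => //; first exact: acN.
apply: ae_imply df _ => t D /D[/derivableP dft D0].
have dN : is_derive t 1 (fun t => - f t) (- 'D_1 f t) by exact: is_deriveN.
by split; [exact: ex_derive | rewrite derive_val oppr_le0].
Qed.

Lemma ac_cst_of_derive0 (a b : R) (f : R -> R) : a <= b ->
  absolutely_continuous a b f ->
  {ae mu, forall t, a <= t <= b -> is_derive t 1 f 0} -> f b = f a.
Proof.
move=> ab acf df; apply/eqP; rewrite eq_le; apply/andP; split.
  by apply: ac_le => //; apply: ae_imply df _ => t D /D ?;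
    split; [exact: ex_derive | rewrite derive_val].
by apply: ac_ge => //; apply: ae_imply df _ => t D /D ?;
  split; [exact: ex_derive | rewrite derive_val].
Qed.

End ac_monotone.

(** * Primitives of locally integrable functions *)

Section primitive.
Variable R : realType.
Notation mu := (@lebesgue_measure R).
Implicit Types h x : R -> R.

Definition primitive (t0 : R) h (t : R) : R := (\int[mu]_(s in `[t0, t]) h s)%R.

Lemma locally_integrable_segment h (a b : R) : locally_integrable setT h ->
  mu.-integrable `[a, b] (EFin \o h).
Proof.
move=> [mh _ fin]; apply/integrableP; split.
  by apply/measurable_EFinP; exact: measurable_funTS.
by have := fin `[a, b]%classic (@subsetT _ _) (@segment_compact _ a b).
Qed.

Lemma primitive_start (t0 : R) h : primitive t0 h t0 = 0.
Proof. by rewrite /primitive set_itv1 Rintegral_set1. Qed.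

Lemma primitive_before (t0 t : R) (h : R -> R) : t < t0 -> primitive t0 h t = 0.
Proof.
by move=> tt0; rewrite /primitive set_itv_ge ?bnd_simp -?ltNge// Rintegral_set0.
Qed.

Lemma primitive_ge0 (t0 t : R) (h : R -> R) : (forall s, 0 <= h s) ->
  0 <= primitive t0 h t.
Proof. by move=> h0; exact: Rintegral_ge0. Qed.

Lemma primitive_le (t0 t : R) (h k : R -> R) : locally_integrable setT h ->
  locally_integrable setT k -> (forall s, h s <= k s) ->
  primitive t0 h t <= primitive t0 k t.
Proof.
by move=> lh lk hk; apply: le_Rintegral => //; exact: locally_integrable_segment.
Qed.

Lemma primitive_sub (t0 u v : R) h : locally_integrable setT h ->
  t0 <= u -> u <= v ->
  primitive t0 h v - primitive t0 h u = (\int[mu]_(s in `]u, v]) h s)%R.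
Proof.
move=> lh t0u uv; apply: (@Rintegral_itvB _ _ (BLeft t0) (BRight v)) => //.
exact: locally_integrable_segment.
Qed.

Lemma primitive_nondecreasing (t0 : R) h : locally_integrable setT h ->
  (forall t, 0 <= h t) -> {homo primitive t0 h : u v / u <= v}.
Proof.
move=> lh h0 u v uv; have [t0u|ut0] := leP t0 u.
  by rewrite -subr_ge0 primitive_sub// Rintegral_ge0.
rewrite {1}/primitive set_itv_ge ?bnd_simp -?ltNge// Rintegral_set0.
exact: Rintegral_ge0.
Qed.

(** Lebesgue's differentiation theorem. *)
Lemma primitive_derive (t0 : R) h : locally_integrable setT h ->
  {ae mu, forall t, t0 <= t -> is_derive t 1 (primitive t0 h) (h t)}.
Proof.
move=> lh.
(* At [t0] itself the primitive need only have a one-sided derivative. *)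
have ne : {ae mu, forall t, t != t0}.
  exists [set t0]; split => //; first exact: lebesgue_measure_set1.
  by move=> t /= /negP; rewrite negbK => /eqP.
have ftc := @FTC1 R h (BLeft t0) (fun y => locally_integrable_segment t0 y lh) lh.
apply: ae_imply (ae_conj ne ftc) _ => t [tt0 ftc_t] t0t.
have [|dF F'] := ftc_t.
  by rewrite lte_fin lt_neqAle eq_sym tt0.
by split => //; rewrite -derive1E.
Qed.

(** The increments over a family of intervals add up to at most the integral of
    [`|h|] over their union, a set of small measure. *)
Lemma primitive_ac (t0 b : R) h : locally_integrable setT h ->
  absolutely_continuous t0 b (primitive t0 h).
Proof.
move=> lh e e0.
have hint : mu.-integrable setT (EFin \o h \_ `[t0, b]).
  rewrite -restrict_EFin; apply/integrable_restrict => //=; rewrite setTI.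
  exact: locally_integrable_segment.
have [d [d0 hd]] := integral_normr_continuous hint e0.
exists d => // m u v uv triv ltd.
pose I i : set R := `]u i, v i[%classic.
pose A : set R := \big[setU/set0]_(i < m) I i.
have mI i : measurable (I i) by exact: measurable_itv.
have mA : measurable A by exact: bigsetU_measurable.
have muA : (mu A < d%:E)%E.
  rewrite /A measure_semi_additive_ord//.
  apply: (@le_lt_trans _ _ (\sum_(i < m) (v i - u i))%:E); last by rewrite lte_fin.
  rewrite -sumEFin lee_sum// => i _.
  rewrite [leLHS]lebesgue_measure_itv/= lte_fin; case: ltP => // vu.
  by rewrite lee_fin subr_ge0; have [_ []] := uv i.
apply: le_lt_trans (hd A mA muA).
have mh : measurable_fun setT h by case: lh.
pose k := fun s => `|(h \_ `[t0, b]) s|.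
have mk : measurable_fun setT k.
  apply: measurableT_comp => //; apply/(measurable_restrictT _ _).1 => //.
  exact: measurable_funTS.
have kint :  mu.-integrable setT (EFin \o k) by exact: integrable_norm hint.
have -> : (\int[mu]_(s in A) k s = \sum_(i < m) \int[mu]_(s in I i) k s)%R.
  rewrite /Rintegral /A integral_bigsetU_EFin//=; last 3 first.
  - exact: index_enum_uniq.
  - exact: sub_trivIset triv.
  - by apply/measurable_EFinP; exact: measurable_funTS.
  rewrite sum_fine// => i _; apply: integrable_fin_num; first exact: mI.
  by apply: integrableS kint => //; exact: mI.
apply: ler_sum => i _; have [t0u [uvi vb]] := uv i.
rewrite primitive_sub//.
have hi : mu.-integrable `]u i, v i] (EFin \o h).
  apply: integrableS (locally_integrable_segment (u i) (v i) lh) => //.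
  exact: subset_itv_oc_cc.
apply: (le_trans (le_normr_Rintegral _ hi)) => //.
rewrite -Rintegral_itv_bndo_bndc//.
  rewrite le_eqVlt; apply/orP; left; apply/eqP; apply: eq_Rintegral => s.
  rewrite inE/= in_itv/= => /andP[us sv].
  by rewrite /k patchE mem_set//= in_itv/= (le_trans t0u (ltW us)) (le_trans (ltW sv) vb).
by apply: integrableS (integrable_norm hi) => //; exact: subset_itv_oo_oc.
Qed.

Lemma primitive_monotone_cvg (t0 t : R) (h : nat -> R -> R) (k : R -> R) :
  (forall n, locally_integrable setT (h n)) -> locally_integrable setT k ->
  (forall n s, 0 <= h n s) -> (forall s, nondecreasing_seq (h ^~ s)) ->
  (forall s, h n s @[n --> \oo] --> k s) ->
  primitive t0 (h n) t @[n --> \oo] --> primitive t0 k t.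
Proof.
move=> lh lk h0 ndh hk.
have mh n : measurable_fun setT (h n) by have [] := lh n.
have limE s : limn (fun n => (h n s)%:E) = (k s)%:E.
  apply/cvg_lim => //; apply/fine_cvgP; split; last exact: hk.
  exact: nearW.
apply: fine_cvg; rewrite fineK; last first.
  by apply: integrable_fin_num => //; exact: locally_integrable_segment.
have -> : (\int[mu]_(s in `[t0, t]) (k s)%:E =
    \int[mu]_(s in `[t0, t]) limn (fun n => (h n s)%:E))%E.
  by apply: eq_integral => s _; rewrite limE.
apply: cvg_monotone_convergence => //.
- by move=> n; apply/measurable_EFinP; apply: measurable_funTS; exact: mh.
- by move=> n s _; rewrite lee_fin.
- by move=> s _ m n mn; rewrite lee_fin; exact: ndh.
Qed.

End primitive.

(** * Borel representatives *)

Section borel_representative.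
Variable R : realType.
Notation mu := (@lebesgue_measure R).
Notation cmu := (@completed_lebesgue_measure R).
Notation cara := ((@wlength R idfun)^*%mu.-cara.-measurable).

Lemma cara_decomposition (A : set R) : cara A ->
  exists BN : set R * set R,
    [/\ measurable BN.1, mu.-negligible BN.2 & BN.1 `|` BN.2 = A].
Proof.
rewrite -completed_caratheodory_measurable g_sigma_completed_algebra_genE.
by move=> [B mB [N negN <-]]; exists (B, N).
Qed.

(** The identity map, from the completed to the Borel sigma-algebra, pushes the
    completed measure forward to the Lebesgue measure. *)
Lemma integral_completed (D : set R) (h : R -> R) :
  measurable D -> measurable_fun setT h -> (forall t, 0 <= h t) ->
  (\int[mu]_(x in D) (h x)%:E = \int[cmu]_(x in D) (h x)%:E)%E.
Proof.
move=> mD mh h0.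
pose phi : caratheodory_type (@wlength R idfun)^*%mu -> measurableTypeR R := idfun.
have mphi : measurable_fun setT phi.
  by move=> _ A mA; rewrite setTI; exact: sub_caratheodory.
have := @ge0_integral_pushforward _ _ _ _ R phi mphi cmu D (EFin \o h) mD.
rewrite preimage_id => <-.
- exact: eq_measure_integral.
- by apply/measurable_EFinP; exact: measurable_funTS.
- by move=> y _ /=; rewrite lee_fin.
Qed.

Lemma ae_completed (P : R -> Prop) : {ae mu, forall t, P t} ->
  {ae cmu, forall t, P t}.
Proof.
move=> [N [mN N0 PN]]; exists N; split=> //; exact: sub_caratheodory.
Qed.

Lemma completed_superlevel_measurable (t0 : R) f (r : R) :
  locally_integrable_ray t0 f -> cara [set x | t0 <= x /\ r < f x].
Proof.
move=> lf.
have -> : [set x | t0 <= x /\ r < f x] =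
  \bigcup_n (`[t0, t0 + n%:R] `&` (EFin \o f) @^-1` `]r%:E, +oo[%classic).
  apply/seteqP; split=> [x [t0x rx]|x [n _ [/=]]].
    exists (Num.bound (x - t0)) => //; split=> /=; last by rewrite in_itv/= lte_fin rx.
    by rewrite in_itv/= t0x/= -lerBlDl ltW// archi_boundP// subr_ge0.
  by rewrite !in_itv/= lte_fin => /andP[t0x _] /andP[rx _].
apply: bigcupT_measurable => n.
have /integrableP[mf _] := lf (t0 + n%:R).
apply: mf.
  exact: sub_caratheodory.
exact: emeasurable_itv.
Qed.

(** A nonnegative function is the supremum of the nonnegative rationals [r] below
    it.  Each set where [f > r] is the union of a Borel set and of a negligible
    set, so the supremum of the functions [r] times the indicator of the Borel part
    is Borel and differs from [f] on a countable union of negligible sets only.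
    It vanishes before [t0], hence it is locally integrable on the whole line. *)
Lemma borel_representative (t0 : R) f : locally_integrable_ray t0 f ->
  {ae mu, forall t, t0 <= t -> 0 <= f t} ->
  exists h : R -> R, [/\ locally_integrable setT h, forall t, 0 <= h t &
    {ae mu, forall t, t0 <= t -> h t = f t}].
Proof.
move=> lf f0.
pose r n : R := `|ratr (odflt 0%R (unpickle n : option rat))|.
have [BN BNP] := choice (fun n => cara_decomposition (completed_superlevel_measurable (r n) lf)).
pose B n := (BN n).1; pose N n := (BN n).2.
have mB n : measurable (B n) by have [] := BNP n.
have AE n : B n `|` N n = [set x | t0 <= x /\ r n < f x] by have [] := BNP n.
have BA n x : B n x -> t0 <= x /\ r n < f x.
  by move=> Bx; have : (B n `|` N n) x by [left]; rewrite AE.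
pose g n x : \bar R := (r n * \1_(B n) x)%:E.
have g0 n x : (0 <= g n x)%E by rewrite lee_fin mulr_ge0// normr_ge0.
pose H x := esups (g ^~ x) 0.
have H0 x : (0 <= H x)%E.
  by apply: le_trans (g0 0%N x) _; apply: ereal_sup_ubound; exists 0%N.
have H_le x (y : \bar R) : (0 <= y)%E -> (forall n, B n x -> ((r n)%:E <= y)%E) ->
    (H x <= y)%E.
  move=> y0 By; apply: ge_ereal_sup => _ [n _ <-]; rewrite /g indicE.
  by case: (boolP (x \in B n)) => [/[1!inE] /By|_]; rewrite ?mulr1 ?mulr0.
pose h x := fine (H x).
have mH : measurable_fun setT H.
  apply: measurable_fun_esups => n; apply/measurable_EFinP.
  by apply: measurable_funM => //; exact: measurable_indic.
have mh : measurable_fun setT h by exact: measurableT_comp.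
have h0 x : 0 <= h x by exact: fine_ge0.
have hout x : x < t0 -> h x = 0.
  move=> xt0; suff : (H x <= 0)%E.
    by move=> Hx; rewrite /h (_ : H x = 0%E)//; apply/eqP; rewrite eq_le Hx H0.
  by apply: H_le => // n /BA[]; rewrite leNgt xt0.
have hf : {ae mu, forall t, t0 <= t -> h t = f t}.
  have : mu.-negligible (\bigcup_n N n).
    by apply: negligible_bigcup => n; have [] := BNP n.
  move=> negN; have aeN : {ae mu, forall t, ~ (\bigcup_n N n) t}.
    by apply: negligibleS negN => t /= /contrapT.
  apply: ae_imply (ae_conj f0 aeN) _ => t [f0t Nt] t0t; have {}f0t := f0t t0t.
  suff HE : H t = (f t)%:E by rewrite /h HE.
  apply/eqP; rewrite eq_le; apply/andP; split.
    by apply: H_le => // n /BA[_ /ltW].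
  apply/lee_addgt0Pr => e e0.
  have [fe|ef] := leP (f t) e.
    by rewrite (@le_trans _ _ e%:E) ?lee_fin// leeDr.
  have : f t - e < f t by rewrite ltrBlDr ltrDl.
  move=> /rat_in_itvoo[q]; rewrite in_itv/= => /andP[eq qf].
  have rq : r (pickle q) = ratr q.
    by rewrite /r pickleK/= ger0_norm// ltW// (lt_trans _ eq)// subr_gt0.
  have Bt : B (pickle q) t.
    have : (B (pickle q) `|` N (pickle q)) t by rewrite AE/= rq.
    by case=> // Nqt; exfalso; apply: Nt; exists (pickle q).
  apply: (@le_trans _ _ (g (pickle q) t + e%:E)%E); last first.
    by rewrite leeD2r//; apply: ereal_sup_ubound; exists (pickle q).
  by rewrite /g indicE mem_set// mulr1 rq -EFinD lee_fin -lerBlDr ltW.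
exists h; split=> //; split=> //; first exact: openT.
move=> K _ cK.
have mK : measurable K by exact: compact_measurable.
have [M KM] : exists M, K `<=` `]-oo, M].
  have [M [_ KM]] := compact_bounded cK; exists (M + 1) => x Kx.
  have := KM (M + 1); rewrite ltrDl ltr01 => /(_ isT x Kx) /= xM.
  by rewrite in_itv/= (le_trans (ler_norm _)).
have -> : (\int[mu]_(x in K) `|h x|%:E = \int[mu]_(x in K `&` `[t0, M]) (h x)%:E)%E.
  rewrite integral_mkcondr; apply: eq_integral => x; rewrite inE => Kx.
  rewrite patchE ger0_norm//; case: ifPn => //; rewrite notin_setE/= in_itv/=.
  have := KM x Kx; rewrite /= in_itv/= => ->; rewrite andbT => /negP.
  by rewrite -ltNge => /hout ->.
apply: (@le_lt_trans _ _ (\int[mu]_(x in `[t0, M]) (h x)%:E)%E).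
  apply: ge0_subset_integral => //; first exact: measurableI.
    by apply/measurable_EFinP; exact: measurable_funTS.
  by move=> x _; rewrite lee_fin.
rewrite integral_completed//.
have /integrableP[mf] := lf M; apply: le_lt_trans.
have mD : cara `[t0, M]%classic by exact: sub_caratheodory.
have mch : measurable_fun
    (`[t0, M]%classic : set (caratheodory_type (@wlength R idfun)^*%mu)) (EFin \o h).
  move=> _ A mA; have := (measurable_EFinP _ _).2 mh measurableT A mA.
  rewrite setTI => mhA; apply: measurableI => //; exact: sub_caratheodory.
rewrite le_eqVlt; apply/orP; left; apply/eqP; apply: ge0_ae_eq_integral => //.
- exact: measurableT_comp mf.
- by move=> x _; rewrite lee_fin.
apply: ae_completed; apply: ae_imply (ae_conj f0 hf) _ => x [f0x hfx].
rewrite /= in_itv/= => /andP[t0x _].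
by rewrite hfx// ger0_norm// f0x.
Qed.

End borel_representative.

(** * Cooperative linear systems *)

Section cooperative_system.
Variable R : realType.
Notation mu := (@lebesgue_measure R).

(** Monotone functions are measurable and locally bounded.  The Picard iterates
    below are monotone, so this gives the integrability of every integrand. *)
Lemma locally_integrableM_nondecreasing (g x : R -> R) :
  locally_integrable setT g -> {homo x : s t / s <= t} ->
  locally_integrable setT (fun t => g t * x t).
Proof.
move=> [mg oT lg] ndx.
have mx : measurable_fun setT x by exact: nondecreasing_measurable.
split=> //; first exact: measurable_funM.
move=> K KT cK.
have mK : measurable K by exact: compact_measurable.
have [M [_ KM]] := compact_bounded cK.
have gK : mu.-integrable K (EFin \o g).
  apply/integrableP; split; last exact: lg.
  by apply/measurable_EFinP; exact: measurable_funTS.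
have xK : [bounded x t | t in K].
  exists (`|x (- (M + 1))| + `|x (M + 1)|); split; first exact: num_real.
  move=> y ltxy t Kt; apply: le_trans (ltW ltxy).
  have := KM (M + 1); rewrite ltrDl ltr01 => /(_ isT t Kt) /=.
  rewrite ler_norml => /andP[/ndx xl /ndx xr].
  have := ler_norm (x (M + 1)); have := ler_norm (- x (- (M + 1))).
  have := normr_ge0 (x (M + 1)); have := normr_ge0 (x (- (M + 1))).
  by rewrite normrN ler_norml => *; lra.
have := @integrableMl _ _ _ mu K mK (EFin \o g) x gK (measurable_funTS mx) xK.
by move=> /integrableP[_].
Qed.

(** Each unknown [x i] is driven by the single unknown [x (sigma i)], with a
    nonnegative coefficient.  The Picard iterates starting from [0] therefore
    increase with the number of steps, and they remain below the exponential [E] of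
    the primitive of [G], since [E' = G E] bounds their derivatives.  Monotone
    convergence then passes to the limit under the integral. *)
Theorem cooperative_system (t0 : R) (I : Type) (sigma : I -> I)
    (g : I -> R -> R) (G : R -> R) (c : I -> R) :
  (forall i, locally_integrable setT (g i)) -> locally_integrable setT G ->
  (forall i t, 0 <= g i t <= G t) -> (forall i, 0 <= c i <= 1) ->
  exists x : I -> R -> R,
    (forall i, {homo x i : s t / s <= t}) /\
    (forall i t, x i t = c i + primitive t0 (fun s => g i s * x (sigma i) s) t).
Proof.
move=> lg lG gG c01.
have g0 i t : 0 <= g i t by have /andP[] := gG i t.
pose X := fix X k (i : I) (t : R) : R := if k is k'.+1 then
  c i + primitive t0 (fun s => g i s * X k' (sigma i) s) t else 0.
have Xmon k : forall i, {homo X k i : s t / s <= t} /\ forall t, 0 <= X k i t.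
  elim: k => [|k IH] i; first by split=> // t; exact: lexx.
  have [ndX X0] := IH (sigma i).
  split=> [s t st /=|t /=].
    rewrite lerD2l; apply: primitive_nondecreasing => //.
      exact: locally_integrableM_nondecreasing.
    by move=> r; rewrite mulr_ge0.
  rewrite addr_ge0//; first by have /andP[] := c01 i.
  by apply: primitive_ge0 => s; rewrite mulr_ge0.
have ndX k i := (Xmon k i).1; have X0 k i := (Xmon k i).2.
have lgX k i : locally_integrable setT (fun s => g i s * X k (sigma i) s).
  exact: locally_integrableM_nondecreasing.
have XS k : forall i t, X k i t <= X k.+1 i t.
  elim: k => [|k IH] i t; first exact: (X0 1%N).
  rewrite /= lerD2l; apply: primitive_le => [||s].
  - exact: lgX.
  - exact: (lgX k.+1).
  by rewrite ler_wpM2l//; exact: IH.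
pose E t := expR (primitive t0 G t).
have XE k : forall i t, X k i t <= E t.
  elim: k => [|k IH] i t; first by rewrite expR_ge0.
  have /andP[c0 c1] := c01 i.
  have [t0t|tt0] := leP t0 t; last first.
    by rewrite /E /= !primitive_before// addr0 expR0.
  (* [X k.+1 i - E] is at most [0] at [t0] and does not increase after [t0]. *)
  rewrite -subr_le0.
  have start : X k.+1 i t0 - E t0 <= 0.
    by rewrite /E /= !primitive_start addr0 expR0 subr_le0.
  apply: le_trans start.
  apply: (@ac_le _ _ _ (fun s => X k.+1 i s - E s)) => //.
    apply: acB; first by apply: acD; [exact: ac_cst | exact: primitive_ac].
    by apply: ac_expR; exact: primitive_ac.
  have dG := primitive_derive t0 lG; have dX := primitive_derive t0 (lgX k i).
  apply: ae_imply (ae_conj dG dX) _ => s [dGs dXs] /andP[t0s _].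
  have {}dGs := dGs t0s; have {}dXs := dXs t0s.
  have dE : is_derive s 1 (fun r => X k.+1 i r - E r)
      (0 + g i s * X k (sigma i) s - G s * E s).
    by apply: is_derive_sub; exact: is_derive_exp.
  split; first exact: ex_derive.
  rewrite derive_val add0r subr_le0.
  have /andP[? ?] := gG i s.
  by rewrite ler_pM.
have cvX i t : cvgn (fun k => X k i t).
  apply: nondecreasing_is_cvgn; last by exists (E t) => _ [k _ <-].
  by apply/nondecreasing_seqP => k.
pose x i t := limn (fun k => X k i t).
have ndx i : {homo x i : s t / s <= t}.
  move=> s t st; apply: ler_lim; [exact: cvX|exact: cvX|].
  by apply: nearW => k; exact: ndX.
exists x; split=> // i t.
have cv1 : X k.+1 i t @[k --> \oo] --> x i t.
  by have := cvX i t; rewrite (cvg_shiftS (fun k => X k i t)).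
apply: (cvg_unique _ cv1) => //=.
apply: cvgD; first exact: cvg_cst.
apply: primitive_monotone_cvg => //.
- exact: locally_integrableM_nondecreasing.
- by move=> n s; rewrite mulr_ge0.
- by move=> s; apply/nondecreasing_seqP => k; rewrite ler_wpM2l.
- by move=> s; apply: cvgMr => //; exact: cvX.
Qed.

End cooperative_system.

(** * The linear system of the ordinary differential equation *)

Section linear_system.
Variable R : realType.
Notation mu := (@lebesgue_measure R).
Variables (t0 : R) (P Q : R -> R).

(** With [P = 1 / p], [v] is the quasi-derivative [p u'] of a solution [u] of
    [(p u')' + Q u = 0]. *)
Definition linear_solution (u v : R -> R) : Prop :=
  [/\ locally_AC_ray t0 u, locally_AC_ray t0 v,
      {ae mu, forall t, t0 <= t -> is_derive t 1 u (P t * v t)} &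
      {ae mu, forall t, t0 <= t -> is_derive t 1 v (- (Q t * u t))}].

Lemma linear_solution_comb (al be : R) u1 v1 u2 v2 :
  linear_solution u1 v1 -> linear_solution u2 v2 ->
  linear_solution (fun t => al * u1 t + be * u2 t)
                  (fun t => al * v1 t + be * v2 t).
Proof.
move=> [acu1 acv1 du1 dv1] [acu2 acv2 du2 dv2]; split.
- by move=> b; apply: acD; exact: acZ.
- by move=> b; apply: acD; exact: acZ.
- apply: ae_imply (ae_conj du1 du2) _ => t [D1 D2] t0t.
  have := is_derive_add (is_derive_scale (D1 t0t) al) (is_derive_scale (D2 t0t) be).
  by move/is_derive_eq; apply; ring.
- apply: ae_imply (ae_conj dv1 dv2) _ => t [D1 D2] t0t.
  have := is_derive_add (is_derive_scale (D1 t0t) al) (is_derive_scale (D2 t0t) be).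
  by move/is_derive_eq; apply; ring.
Qed.

Hypotheses (lP : locally_integrable setT P) (lQ : locally_integrable setT Q).
Hypotheses (P0 : forall t, 0 <= P t) (Q0 : forall t, 0 <= Q t).

(** Write [u] and [v] as differences of the unknowns [x (false, _)] and
    [x (true, _)], the second index telling [v] from [u].  The coefficient [- Q]
    becomes [Q] by exchanging the two signs: [u] is driven by the [v] of the same
    sign and [v] by the [u] of the other sign, a cycle of length four with
    nonnegative coefficients. *)
Lemma linear_solution_start (a b : R) : 0 <= a <= 1 -> 0 <= b <= 1 ->
  exists u v, [/\ linear_solution u v, u t0 = a & v t0 = b].
Proof.
move=> a01 b01.
pose sigma (i : bool * bool) := if i.2 then (~~ i.1, false) else (i.1, true).
pose g (i : bool * bool) := if i.2 then Q else P.
pose c (i : bool * bool) := if i.1 then 0 else if i.2 then b else a.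
have [||||x [ndx xE]] := @cooperative_system R t0 _ sigma g (P \+ Q) c.
- by move=> [? []].
- exact: locally_integrableD.
- by move=> [? []] t; rewrite /g/= ?P0 ?Q0/= ?lerDl ?lerDr.
- by move=> [[] []]; rewrite /c/= ?lexx ?ler01.
have acx i d : absolutely_continuous t0 d (x i).
  rewrite (_ : x i = fun t => c i + primitive t0 (fun s => g i s * x (sigma i) s) t);
    last exact/funext/xE.
  apply: acD; first exact: ac_cst.
  apply: primitive_ac; apply: locally_integrableM_nondecreasing => //.
  by case: i => [? []].
have dx i : {ae mu, forall t, t0 <= t -> is_derive t 1 (x i) (g i t * x (sigma i) t)}.
  have lgx : locally_integrable setT (fun s => g i s * x (sigma i) s).
    apply: locally_integrableM_nondecreasing => //.
    by case: i => [? []].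
  apply: ae_imply (primitive_derive t0 lgx) _ => t dt /dt {}dt.
  rewrite (_ : x i = fun t => c i + primitive t0 (fun s => g i s * x (sigma i) s) t);
    last exact/funext/xE.
  rewrite -[_ * _]add0r.
  exact: is_derive_add.
have xc i : x i t0 = c i by rewrite xE primitive_start addr0.
exists (fun t => x (false, false) t - x (true, false) t),
       (fun t => x (false, true) t - x (true, true) t); split.
- split.
  + by move=> d; exact: acB.
  + by move=> d; exact: acB.
  + apply: ae_imply (ae_conj (dx (false, false)) (dx (true, false))) _ => t [D1 D2] t0t.
    have := is_derive_sub (D1 t0t) (D2 t0t); move/is_derive_eq; apply; rewrite /sigma /g /=; ring.
  + apply: ae_imply (ae_conj (dx (false, true)) (dx (true, true))) _ => t [D1 D2] t0t.
    have := is_derive_sub (D1 t0t) (D2 t0t); move/is_derive_eq; apply; rewrite /sigma /g /=; ring.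
- by rewrite !xc subr0.
- by rewrite !xc subr0.
Qed.

Lemma wronskian_cst u1 v1 u2 v2 (T : R) : t0 <= T ->
  linear_solution u1 v1 -> linear_solution u2 v2 ->
  u1 T * v2 T - u2 T * v1 T = u1 t0 * v2 t0 - u2 t0 * v1 t0.
Proof.
move=> t0T [acu1 acv1 du1 dv1] [acu2 acv2 du2 dv2].
apply: (@ac_cst_of_derive0 _ t0 T (fun t => u1 t * v2 t - u2 t * v1 t)) => //.
  by apply: acB; exact: acM.
apply: ae_imply (ae_conj du1 (ae_conj dv1 (ae_conj du2 dv2))) _.
move=> t [D1 [D2 [D3 D4]]] /andP[t0t _].
have := is_derive_sub (is_derive_mul (D1 t0t) (D4 t0t)) (is_derive_mul (D3 t0t) (D2 t0t)).
by move/is_derive_eq; apply; ring.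
Qed.

(** The solutions with data [(1, 0)] and [(0, 1)] at [t0] have Wronskian [1], so
    Cramer's rule at [T] yields a combination with any prescribed data there. *)
Lemma linear_solution_through (T A B : R) : t0 <= T ->
  exists u v, [/\ linear_solution u v, u T = A & v T = B].
Proof.
move=> t0T.
have [||u1 [v1 [S1 u10 v10]]] := @linear_solution_start 1 0; rewrite ?lexx ?ler01//.
have [||u2 [v2 [S2 u20 v20]]] := @linear_solution_start 0 1; rewrite ?lexx ?ler01//.
have := wronskian_cst t0T S1 S2.
rewrite u10 v10 u20 v20 mulr1 mulr0 subr0 => W.
have := linear_solution_comb (A * v2 T - B * u2 T) (B * u1 T - A * v1 T) S1 S2.
move=> S; eexists; eexists; split; first exact: S.
- by rewrite -[RHS]mulr1 -W; ring.
- by rewrite -[RHS]mulr1 -W; ring.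
Qed.

End linear_system.

(** * Comparison with a positive supersolution *)

Section comparison.
Variable R : realType.
Notation mu := (@lebesgue_measure R).

(** At the first zero [s] of [u] the nonincreasing function [u psi - phi v],
    which is [0] at [T], forces [v s >= 0]; as [v] does not increase while [u >= 0], [v] is
    nonnegative and [u] nondecreasing on [[T, s]], so [u s >= u T > 0]. *)
Lemma linear_solution_gt0 (t0 T : R) (P Q u v phi psi : R -> R) : t0 <= T ->
  (forall t, 0 <= P t) -> (forall t, 0 <= Q t) ->
  linear_solution t0 P Q u v ->
  locally_AC_ray T phi -> locally_AC_ray T psi ->
  (forall t, T <= t -> 0 < phi t) ->
  {ae mu, forall t, T <= t -> is_derive t 1 phi (P t * psi t)} ->
  {ae mu, forall t, T <= t ->
     derivable psi t 1 /\ 'D_1 psi t + Q t * phi t <= 0} ->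
  u T = phi T -> v T = psi T ->
  forall t, T <= t -> 0 < u t.
Proof.
move=> t0T P0 Q0 [acu acv du dv] acphi acpsi phi0 dphi dpsi uT vT t Tt.
rewrite ltNge; apply/negP => ut.
have acuT b : absolutely_continuous T b u by apply: ac_sub (acu b).
have acvT b : absolutely_continuous T b v by apply: ac_sub (acv b).
have uT0 : 0 < u T by rewrite uT phi0.
have [s [/andP[Ts st] us before]] :=
  first_zero Tt (ac_within_continuous (acuT t)) uT0 ut.
have u0 r : T <= r <= s -> 0 <= u r.
  move=> /andP[Tr]; rewrite le_eqVlt => /predU1P[->|rs]; first by rewrite us.
  by rewrite ltW// before// Tr.
have vs : 0 <= v s.
  suff : u s * psi s - phi s * v s <= u T * psi T - phi T * v T.
    rewrite us uT vT mul0r sub0r subrr oppr_le0.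
    by rewrite pmulr_rge0// phi0// ltW.
  apply: (@ac_le _ T s (fun r => u r * psi r - phi r * v r)); first exact: ltW.
    by apply: acB; apply: acM.
  apply: ae_imply (ae_conj (ae_conj du dv) (ae_conj dphi dpsi)) _ => r [[D1 D2] [D3 D4]] Trs.
  have /andP[Tr rs] := Trs.
  have t0r := le_trans t0T Tr.
  have [dpsir D4'] := D4 Tr.
  have /derivableP D5 : derivable psi r 1 by [].
  have D := is_derive_sub (is_derive_mul (D1 t0r) D5) (is_derive_mul (D3 Tr) (D2 t0r)).
  split; first exact: ex_derive.
  rewrite derive_val.
  (* The terms in [P r * v r * psi r] cancel. *)
  rewrite [X in X <= 0](_ : _ = u r * ('D_1 psi r + Q r * phi r)); last by ring.
  by rewrite mulr_ge0_le0// u0.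
have v0 r : T <= r <= s -> 0 <= v r.
  move=> /andP[Tr rs]; apply: le_trans vs _.
  apply: ac_le => //; first exact: ac_sub (acvT s).
  apply: ae_imply dv _ => z D /andP[rz zs].
  have {}D := D (le_trans t0T (le_trans Tr rz)).
  split; first exact: ex_derive.
  by rewrite derive_val oppr_le0 mulr_ge0// u0// zs (le_trans Tr).
have : u T <= u s.
  apply: ac_ge => //; first exact: ltW.
  apply: ae_imply du _ => z D /andP[Tz zs].
  have {}D := D (le_trans t0T Tz).
  split; first exact: ex_derive.
  by rewrite derive_val mulr_ge0// v0// Tz.
by rewrite us leNgt uT0.
Qed.

Lemma ode_initial_time (t0 : R) : initial_time t0 (fun (_ : 'I_1) (t : R) => t) = t0.
Proof.
rewrite /initial_time (_ : [set x | _] = `[t0, +oo[%classic).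
  by rewrite inf_itv// minxx.
apply/seteqP; split=> x /=; rewrite in_itv/= andbT.
  by move=> [_ [t t0t ->]].
by move=> t0x; exists ord0, x.
Qed.

(** The solution that agrees with [phi] and [psi] at [T] is positive after
    [T].  It is constructed for Borel representatives of [1 / p] and [Q], and it
    also solves the original equation, which is required almost everywhere only. *)
Lemma positive_supersolution_nonoscillatory (t0 T : R) (p Q phi psi : R -> R) :
  t0 <= T ->
  {ae mu, forall t, t0 <= t -> 0 < p t} ->
  locally_integrable_ray t0 (fun t => (p t)^-1) ->
  {ae mu, forall t, t0 <= t -> 0 <= Q t} -> locally_integrable_ray t0 Q ->
  locally_AC_ray T phi -> locally_AC_ray T psi ->
  (forall t, T <= t -> 0 < phi t) ->
  {ae mu, forall t, T <= t -> derivable phi t 1 /\ psi t = p t * 'D_1 phi t} ->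
  {ae mu, forall t, T <= t ->
     derivable psi t 1 /\ 'D_1 psi t + Q t * phi t <= 0} ->
  ~ ode_oscillatory t0 p Q.
Proof.
move=> t0T p0 ip Q0 iQ acphi acpsi phi0 dphi dpsi osc.
have ip0 : {ae mu, forall t, t0 <= t -> 0 <= (p t)^-1}.
  by apply: ae_imply p0 _ => t pt t0t; rewrite invr_ge0 ltW// pt.
have [P [lP P0 Pp]] := borel_representative ip ip0.
have [Q' [lQ Q'0 QQ]] := borel_representative iQ Q0.
have [u [v [S uT vT]]] := linear_solution_through lP lQ P0 Q'0 (phi T) (psi T) t0T.
have upos : forall t, T <= t -> 0 < u t.
  apply: (linear_solution_gt0 t0T P0 Q'0 S acphi acpsi) => //.
    apply: ae_imply (ae_conj dphi (ae_conj p0 Pp)) _ => t [D [pt Pt]] Tt.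
    have t0t := le_trans t0T Tt; have [dt ->] := D Tt.
    by rewrite Pt// mulKf ?gt_eqF ?pt.
  apply: ae_imply (ae_conj dpsi QQ) _ => t [D Qt] Tt.
  by rewrite Qt ?(le_trans t0T)//; exact: D.
have [acu acv du dv] := S.
suff sol : is_solution t0 p (fun _ : 'I_1 => Q) (fun _ t => t) u.
  have [|t Tt ut] := osc u sol T; first by rewrite ode_initial_time.
  by have := upos t Tt; rewrite ut ltxx.
split=> //.
  by rewrite ode_initial_time; exact: locally_ac_within_continuous.
exists v; split=> //.
  apply: ae_imply (ae_conj du (ae_conj p0 Pp)) _ => t [D [pt Pt]] t0t.
  have {}D := D t0t; split; first exact: ex_derive.
  by rewrite derive_val Pt// mulVKf// gt_eqF// pt.
apply: ae_imply (ae_conj dv QQ) _ => t [D Qt] t0t.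
have {}D := D t0t; split; first exact: ex_derive.
by rewrite derive_val big_ord1 Qt// addNr.
Qed.

End comparison.

(** * The functional differential equation *)

Section functional_equation.
Variable R : realType.
Notation mu := (@lebesgue_measure R).

Variables (n : nat) (t0 : R) (p : R -> R) (q alpha : 'I_n -> R -> R).

Lemma is_solutionN (phi : R -> R) : is_solution t0 p q alpha phi ->
  is_solution t0 p q alpha (fun t => - phi t).
Proof.
move=> [cphi acphi [psi [acpsi dphi dpsi]]].
have dN (f : R -> R) t : derivable f t 1 -> is_derive t 1 (fun s => - f s) (- 'D_1 f t).
  by move=> /derivableP Df; exact: is_deriveN.
split.
- by move=> x; apply: continuousN; exact: cphi.
- by move=> b; exact: acN.
- exists (fun t => - psi t); split.
  + by move=> b; exact: acN.
  + apply: ae_imply dphi _ => t D t0t; have [dt E] := D t0t; have ? := dN _ _ dt.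
    by split; [exact: ex_derive | rewrite derive_val mulrN E].
  + apply: ae_imply dpsi _ => t D t0t; have [dt E] := D t0t; have ? := dN _ _ dt.
    split; first exact: ex_derive.
    under eq_bigr do rewrite mulrN.
    by rewrite derive_val sumrN -opprD E oppr0.
Qed.

Lemma locally_integrable_ray_sum (Om : set 'I_n) :
  (forall k, locally_integrable_ray t0 (q k)) ->
  locally_integrable_ray t0 (fun t => \sum_(k < n | k \in Om) q k t).
Proof.
move=> lq b.
rewrite (_ : EFin \o _ = (fun t => \sum_(k < n | k \in Om) (q k t)%:E)%E); last first.
  by apply/funext => t /=; rewrite sumEFin.
apply: integrable_sum => [|k _]; last exact: lq.
by apply: sub_caratheodory; exact: measurable_itv.
Qed.

Lemma ae_eventually_forall (Om : set 'I_n) (A : 'I_n -> R -> Prop) :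
  (forall k, Om k -> exists2 s, t0 <= s & {ae mu, forall t, s <= t -> A k t}) ->
  exists2 s, t0 <= s & {ae mu, forall t, s <= t -> forall k, Om k -> A k t}.
Proof.
move=> evA.
have /choice[s sP] k : exists s, Om k -> {ae mu, forall t, s <= t -> A k t}.
  have [/evA[s _ sA]|nOm] := pselect (Om k); first by exists s.
  by exists 0.
exists (\big[Num.max/t0]_(k < n) s k); first exact: bigmax_ge_id.
have aeP : {ae mu, forall t, forall k, Om k -> s k <= t -> A k t}.
  apply: filter_forall => k; have [/sP Ok|nOm] := pselect (Om k).
    by apply: ae_imply Ok _ => t + _.
  by apply: aeW => t.
apply: ae_imply aeP _ => t At st k Ok; apply: At => //.
by apply: le_trans st; exact: le_bigmax.
Qed.

Hypotheses (lq : forall k, locally_integrable_ray t0 (q k))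
  (p0 : {ae mu, forall t, t0 <= t -> 0 < p t})
  (ip : locally_integrable_ray t0 (fun t => (p t)^-1))
  (q0 : forall k, {ae mu, forall t, t0 <= t -> 0 <= q k t})
  (alphay : forall k, alpha k t @[t --> +oo] --> +oo).

Lemma deviations_eventually_ge (M : R) :
  exists2 s, t0 <= s & forall k t, s <= t -> M <= alpha k t.
Proof.
have : \forall t \near +oo, forall k, M <= alpha k t.
  by apply: filter_forall => k; move: (alphay k) => /cvgryPge; exact.
move=> [s [_ sP]]; exists (Num.max t0 (s + 1)); first by rewrite le_max lexx.
move=> k t; rewrite ge_max => /andP[_ st]; apply: sP.
by rewrite (lt_le_trans _ st)// ltrDl.
Qed.

Lemma ae_coefficients_ge0 : {ae mu, forall t, t0 <= t -> forall k, 0 <= q k t}.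
Proof.
have : {ae mu, forall t, forall k, t0 <= t -> 0 <= q k t} by exact: filter_forall.
by move=> aeq; apply: ae_imply aeq _ => t qt t0t k; exact: qt.
Qed.

Section positive_solution.
Variables (phi psi : R -> R) (T : R).
Hypotheses (acphi : locally_AC_ray t0 phi) (acpsi : locally_AC_ray t0 psi)
  (dphi : {ae mu, forall t, t0 <= t -> derivable phi t 1 /\ psi t = p t * 'D_1 phi t})
  (dpsi : {ae mu, forall t, t0 <= t -> derivable psi t 1 /\
             'D_1 psi t + \sum_(k < n) q k t * phi (alpha k t) = 0})
  (t0T : t0 <= T)
  (phi0 : forall t, T <= t -> 0 < phi t)
  (phialpha0 : forall k t, T <= t -> 0 < phi (alpha k t)).

(** The terms with index outside [Om] are nonnegative, and the others do not
    increase when [phi (alpha k t)] is replaced by [phi t]. *)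
Lemma ode_not_oscillatory_of_deviation (Om : set 'I_n) (S : R) : T <= S ->
  {ae mu, forall t, S <= t -> forall k, Om k -> phi t <= phi (alpha k t)} ->
  ~ ode_oscillatory t0 p (fun t => \sum_(k < n | k \in Om) q k t).
Proof.
move=> TS dev; have t0S := le_trans t0T TS.
apply: (@positive_supersolution_nonoscillatory _ t0 S p _ phi psi) => //.
- apply: ae_imply ae_coefficients_ge0 _ => t qt t0t.
  by apply: sumr_ge0 => k _; exact: qt.
- exact: locally_integrable_ray_sum.
- by move=> b; apply: ac_sub (acphi b).
- by move=> b; apply: ac_sub (acpsi b).
- by move=> t St; apply: phi0; exact: le_trans St.
- by apply: ae_imply dphi _ => t D St; apply: D; exact: le_trans St.
- apply: ae_imply (ae_conj dpsi (ae_conj ae_coefficients_ge0 dev)) _ => t [D [qt devt]] St.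
  have t0t := le_trans t0S St; have [dt E] := D t0t; split=> //.
  rewrite -[leRHS]E lerD2l mulr_suml big_mkcond/=; apply: ler_sum => k _.
  case: ifPn => [|_]; first by rewrite inE => Ok; rewrite ler_wpM2l ?qt// devt.
  by rewrite mulr_ge0 ?qt// ltW// phialpha0// (le_trans TS).
Qed.

Lemma quasi_derivative_nonincreasing (s t : R) : T <= s -> s <= t -> psi t <= psi s.
Proof.
move=> Ts st; apply: ac_le => //.
  by apply: ac_sub (acpsi t); rewrite ?(le_trans t0T).
apply: ae_imply (ae_conj dpsi ae_coefficients_ge0) _ => r [D qr] /andP[sr _].
have Tr := le_trans Ts sr; have t0r := le_trans t0T Tr.
have [dr /eqP] := D t0r; rewrite addr_eq0 => /eqP E; split=> //.
rewrite E oppr_le0 sumr_ge0// => k _.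
by rewrite mulr_ge0 ?qr// ltW// phialpha0.
Qed.

(** Since [psi] is nonincreasing, either it is nonnegative throughout or it is
    negative from some time [S] on.  The first case makes [phi] nondecreasing and
    concerns the advanced arguments, the second one makes [phi] nonincreasing and
    concerns the retarded ones, once they exceed [S]. *)
Lemma no_positive_solution :
  ode_oscillatory t0 p (fun t => \sum_(k < n | k \in Omega_plus t0 alpha) q k t) ->
  ode_oscillatory t0 p (fun t => \sum_(k < n | k \in Omega_minus t0 alpha) q k t) ->
  False.
Proof.
move=> oscp oscm.
have acphi' s t : T <= s -> absolutely_continuous s t phi.
  by move=> Ts; apply: ac_sub (acphi t); rewrite ?(le_trans t0T).
have [psi0|] := pselect (forall t, T <= t -> 0 <= psi t).
  have ndphi s t : T <= s -> s <= t -> phi s <= phi t.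
    move=> Ts st; apply: ac_ge => //; first exact: acphi'.
    apply: ae_imply (ae_conj dphi p0) _ => r [D pr] /andP[sr _].
    have Tr := le_trans Ts sr; have t0r := le_trans t0T Tr.
    have [dr E] := D t0r; split=> //.
    by rewrite -(pmulr_rge0 _ (pr t0r)) -E psi0.
  have [S t0S adv] := @ae_eventually_forall (Omega_plus t0 alpha)
    (fun k t => t <= alpha k t) (fun k Ok => Ok).
  apply: (@ode_not_oscillatory_of_deviation (Omega_plus t0 alpha) (Num.max T S) _ _ oscp).
    by rewrite le_max lexx.
  apply: ae_imply adv _ => t advt; rewrite ge_max => /andP[Tt St] k Ok.
  by apply: ndphi => //; exact: advt.
move=> /existsNP[S /not_implyP[TS /negP]]; rewrite -ltNge => psiS.
have niphi s t : S <= s -> s <= t -> phi t <= phi s.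
  move=> Ss st; apply: ac_le => //; first by apply: acphi'; exact: le_trans Ss.
  apply: ae_imply (ae_conj dphi p0) _ => r [D pr] /andP[sr _].
  have Sr := le_trans Ss sr; have t0r := le_trans t0T (le_trans TS Sr).
  have [dr E] := D t0r; split=> //.
  rewrite -(pmulr_rle0 _ (pr t0r)) -E; apply: le_trans (ltW psiS).
  exact: quasi_derivative_nonincreasing.
have [S1 t0S1 ret] := @ae_eventually_forall (Omega_minus t0 alpha)
  (fun k t => alpha k t <= t) (fun k Ok => Ok).
have [S2 t0S2 alphaS] := deviations_eventually_ge S.
apply: (@ode_not_oscillatory_of_deviation (Omega_minus t0 alpha)
  (Num.max T (Num.max S1 S2)) _ _ oscm).
  by rewrite le_max lexx.
apply: ae_imply ret _ => t rett; rewrite !ge_max => /and3P[Tt S1t S2t] k Ok.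
by apply: niphi; [exact: alphaS | exact: rett].
Qed.

End positive_solution.

End functional_equation.

Unset Implicit Arguments.

Theorem theorem2p2 (R : realType) (n : nat) (t0 : R) (p : R -> R)
    (q alpha : 'I_n -> R -> R) :
  (1 <= n)%N ->
  (forall k, locally_integrable_ray t0 (q k)) ->
  (forall k, locally_bounded_ray t0 (alpha k)) ->
  {ae lebesgue_measure, forall t : R, t0 <= t -> 0 < p t} ->
  locally_integrable_ray t0 (fun t => (p t)^-1) ->
  (forall k, {ae lebesgue_measure, forall t : R, t0 <= t -> 0 <= q k t}) ->
  (forall k, alpha k t @[t --> +oo] --> +oo) ->
  Omega_plus t0 alpha !=set0 ->
  Omega_minus t0 alpha !=set0 ->
  ode_oscillatory t0 p (fun t => \sum_(k < n | k \in Omega_plus t0 alpha) q k t) ->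
  ode_oscillatory t0 p (fun t => \sum_(k < n | k \in Omega_minus t0 alpha) q k t) ->
  oscillatory t0 p q alpha.
Proof.
move=> _ lq _ p0 ip q0 alphay _ _ oscp oscm phi sol T leT.
apply: contrapT => nozero.
have {}nozero t : T <= t -> phi t != 0.
  by move=> Tt; apply/eqP => phit; apply: nozero; exists t.
wlog phiT : phi sol nozero / 0 < phi T.
  move=> wlg; have := nozero T (lexx T); rewrite neq_lt => /orP[phiT|]; last exact: wlg.
  apply: (wlg (fun t => - phi t)); first exact: is_solutionN.
    by move=> t /nozero; rewrite oppr_eq0.
  by rewrite oppr_gt0.
have [cphi acphi [psi [acpsi dphi dpsi]]] := sol.
have phi0 t : T <= t -> 0 < phi t.
  move=> Tt; rewrite ltNge; apply/negP => phit.
  have cphiT : {within `[T, t], continuous phi}.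
    apply: continuous_subspaceW cphi => s /=; rewrite !in_itv/= andbT => /andP[Ts _].
    exact: le_trans Ts.
  have [s [/andP[/ltW/nozero + _] phis _]] := first_zero Tt cphiT phiT phit.
  by rewrite phis eqxx.
have [S t0S alphaT] := deviations_eventually_ge t0 alphay T.
apply: (@no_positive_solution _ _ _ _ _ _ lq p0 ip q0 alphay phi psi (Num.max T S)) => //.
- by rewrite le_max t0S orbT.
- by move=> t; rewrite ge_max => /andP[Tt _]; exact: phi0.
- by move=> k t; rewrite ge_max => /andP[_ St]; apply: phi0; exact: alphaT.
Qed.
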